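(* Let $R$ be a ring. Then the following are equivalent: (1) $R$ is Yaqub nil-clean. (2) For any $a\in R$, there exists $e\in R$ with $e^3=e$ and $ae=ea$ such that $a-e$ is nilpotent or $a+3e$ is nilpotent.
   Context: All rings are associative with identity, not necessarily commutative. A ring $R$ is Yaqub nil-clean if for every $a\in R$, $a+a^3$ is nilpotent or $a-a^3$ is nilpotent. *)

(* Defs.v *)
From mathcomp Require Import all_boot all_order all_algebra.
Set Implicit Arguments.
Unset Strict Implicit.
Unset Printing Implicit Defensive.
Import GRing.Theory.
Local Open Scope ring_scope.

(* [pzRingType] is an arbitrary associative unital ring: it need not be
   commutative, and the zero ring is allowed. *)

Definition nilpotent_elt (R : pzRingType) (x : R) : Prop :=
  exists n : nat, x ^+ n = 0.

Definition Yaqub_nil_clean (R : pzRingType) : Prop :=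
  forall a : R, nilpotent_elt (a + a ^+ 3) \/ nilpotent_elt (a - a ^+ 3).

(* Main.v *)
Require Import Defs.
From HB Require Import structures.
From mathcomp Require Import all_boot all_order all_algebra.
From mathcomp Require Import ring.
Import GRing.Theory.
Local Open Scope ring_scope.

(** Only [a] and at most one element commuting with it are ever involved, so the
    computations can be done in a commutative ring [C] (integer polynomials in
    two variables) mapped to [R] by a morphism [phi]; there the elements with
    nilpotent image form a radical ideal [N], and every step is a polynomial
    identity ([factor_commuting_pair], [nil_imageD], [nil_imageM],
    [nil_image_root]).

    From (1) to (2): the condition at [2] puts [10] or [6] in [N], hence [30].
    The key fact is [tripotent_lift]: when [30] lies in [N], every [b] with
    [b - b^3] in [N] is congruent modulo [N] to an element of [C] whose image is
    tripotent; that image commutes with [a] because [C] is commutative.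
    If [a - a^3] lies in [N], apply it to [b = a].  If [a + a^3] and [10] lie in
    [N], apply it to [b = 3a]: then [b - b^3 = 30a - 27(a + a^3)] lies in [N],
    and [e = 3a] modulo [N] gives [a + 3e = 10a = 0].  If [a + a^3] and [6] lie
    in [N], the condition at [1 + a] forces [2a] into [N], so [a - a^3] lies in
    [N] as well ([nil_image_double]).

    From (2) to (1): the condition at [2] puts [30] in [N].  If [a = e] modulo
    [N] with [e] tripotent, then [a - a^3 = e - e^3 = 0]; if [a = -3e], then
    [a + a^3 = -30e = 0]. *)

(** * Reduction to a commutative ring *)

(** Two commuting elements lie in the image of a commutative ring: evaluate
    integer polynomials in two variables at them. *)
Lemma factor_commuting_pair_nz (R : nzRingType) (a e : R) : a * e = e * a ->
  exists (C : comPzRingType) (phi : {rmorphism C -> R}) (x y : C),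
    phi x = a /\ phi y = e.
Proof.
move=> ae.
have ce : commr_rmorph (intmul 1 : int -> R) e by move=> n; exact: commr_int.
have ca : commr_rmorph (horner_morph ce) a.
  move=> p; rewrite /horner_morph horner_coef.
  apply: commr_sum => i _; apply: commrM; last exact: commrX.
  by rewrite coef_map; apply: commr_int.
exists {poly {poly int}}, (horner_morph ca), 'X, ('X%:P).
split; first exact: horner_morphX.
exact: etrans (horner_morphC ca 'X) (horner_morphX ce).
Qed.

Lemma factor_commuting_pair (R : pzRingType) (a e : R) : a * e = e * a ->
  exists (C : comPzRingType) (phi : {rmorphism C -> R}) (x y : C),
    phi x = a /\ phi y = e.
Proof.
case: (eqVneq (1 : R) 0) => [R0 _|nz].
  have triv (x : R) : x = 0 by rewrite -[x]mul1r R0 mul0r.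
  by exists int, (intmul 1 : int -> R), 0, 0; rewrite [a]triv [e]triv rmorph0.
pose R' : nzRingType := HB.pack R (GRing.PzSemiRing_isNonZero.Build R nz).
exact: (@factor_commuting_pair_nz R' a e).
Qed.

Arguments factor_commuting_pair {R a e}.

(** * The ideal of elements with nilpotent image *)

Section NilpotentImage.

Variables (C : comPzRingType) (R : pzRingType) (phi : {rmorphism C -> R}).
Implicit Types x y : C.

Definition nil_image x := nilpotent_elt (phi x).

Lemma nil_imageM x y : nil_image x -> nil_image (x * y).
Proof.
by case=> n xn; exists n; rewrite -rmorphXn exprMn rmorphM !rmorphXn xn mul0r.
Qed.

Lemma nil_imageN x : nil_image x -> nil_image (- x).
Proof. by rewrite -[- x]mulrN1; apply: nil_imageM. Qed.

Lemma nil_imageD x y : nil_image x -> nil_image y -> nil_image (x + y).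
Proof.
move=> [m xm] [n yn]; exists (m + n)%N; rewrite -rmorphXn exprDn.
rewrite rmorph_sum big1 //.
(* In each term either [x] has exponent at least [m] or [y] at least [n]. *)
move=> i _; rewrite rmorphMn rmorphM !rmorphXn.
have [ni|/ltnW lin] := leqP n i.
  by rewrite -[in phi y ^+ i](subnKC ni) exprD yn mul0r mulr0 mul0rn.
by rewrite -addnBA // exprD xm !mul0r mul0rn.
Qed.

Lemma nil_imageB x y : nil_image x -> nil_image y -> nil_image (x - y).
Proof. by move=> Nx Ny; apply: nil_imageD => //; apply: nil_imageN. Qed.

Lemma nil_image_root n x : nil_image (x ^+ n) -> nil_image x.
Proof. by case=> m xm; exists (n * m)%N; rewrite exprM -rmorphXn. Qed.

Lemma nil_image_subXS n x : nil_image (x - x ^+ 2) -> nil_image (x - x ^+ n.+1).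
Proof.
move=> Nx; elim: n => [|n IHn].
  by exists 1%N; rewrite !expr1 subrr rmorph0.
have -> : x - x ^+ n.+2 = (x - x ^+ n.+1) * x + (x - x ^+ 2).
  by rewrite !exprS; ring.
by apply: nil_imageD => //; apply: nil_imageM.
Qed.

(** * Lifting idempotents and tripotents *)

(** Idempotents lift modulo nilpotents: if [x (1 - x)] has nilpotency index at
    most [n], then [f = 1 - (1 - x^n)^n] works, as [f] is divisible by [x^n]
    and [1 - f] by [(1 - x)^n], while [f = 1 - (1 - x) = x] modulo [x - x^2]. *)
Lemma idempotent_lift x : nil_image (x - x ^+ 2) ->
  exists2 f : C, phi (f ^+ 2 - f) = 0 & nil_image (f - x).
Proof.
move=> Nx; have [n xn] : nil_image (x - x ^+ 2) by [].
(* The exponent is raised by one because [nil_image_subXS] needs it positive. *)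
have {}xn : phi ((x - x ^+ 2) ^+ n.+1) = 0 by rewrite rmorphXn exprS xn mulr0.
set y := 1 - x ^+ n.+1.
have Nxy : nil_image (x - x ^+ n.+1) by exact: nil_image_subXS.
have Ny : nil_image (y - y ^+ 2).
  have -> : y - y ^+ 2 =
      (x - x ^+ 2) + (x - x ^+ n.+1) * (2%:R * x - 1 - (x - x ^+ n.+1)).
    by rewrite /y; ring.
  by apply: nil_imageD => //; apply: nil_imageM.
exists (1 - y ^+ n.+1); last first.
  have -> : 1 - y ^+ n.+1 - x = (y - y ^+ n.+1) - (x - x ^+ n.+1).
    by rewrite /y; ring.
  by apply: nil_imageB => //; apply: nil_image_subXS.
have [z yE] : exists z, y = (1 - x) * z.
  exists (\sum_(i < n.+1) x ^+ i); rewrite /y -opprB subrX1.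
  by rewrite -mulNr opprB.
have [t fE] : exists t, 1 - y ^+ n.+1 = x ^+ n.+1 * t.
  exists (\sum_(i < n.+1) y ^+ i); rewrite -opprB subrX1 -mulNr opprB.
  by congr (_ * _); rewrite /y; ring.
have -> : (1 - y ^+ n.+1) ^+ 2 - (1 - y ^+ n.+1)
    = - ((1 - y ^+ n.+1) * y ^+ n.+1).
  by ring.
rewrite fE yE exprMn.
have -> : x ^+ n.+1 * t * ((1 - x) ^+ n.+1 * z ^+ n.+1)
        = (x - x ^+ 2) ^+ n.+1 * (t * z ^+ n.+1).
  have -> : x - x ^+ 2 = x * (1 - x) by ring.
  by rewrite exprMn; ring.
by rewrite rmorphN rmorphM xn mul0r oppr0.
Qed.

Lemma idempotent_nil_image_eq0 x :
  phi (x ^+ 2 - x) = 0 -> nil_image x -> phi x = 0.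
Proof.
rewrite rmorphB rmorphXn => /subr0_eq xx [n xn].
suff xX m : phi x ^+ m.+1 = phi x by rewrite -(xX n) exprS xn mulr0.
by elim: m => [|m IHm]; rewrite ?expr1 // exprS IHm -expr2.
Qed.

(** Modulo [N], and with [b^3 = b], the element [b] is the difference of the
    orthogonal idempotents [(b^2 + b) / 2] and [(b^2 - b) / 2] where [2] is
    invertible, and is itself idempotent where [2] is nilpotent.  Since
    [Z/30 = Z/15 x Z/2], these two descriptions are glued by polynomials [p]
    and [q] with coefficients [8 = 1/2 mod 15], [8 = 0 mod 2] and
    [23 = 1/2 mod 15], [23 = 1 mod 2].  Lifts of [p] and [q] to idempotents
    stay orthogonal, because their product is both idempotent and nilpotent;
    so their difference is tripotent. *)
Lemma tripotent_lift b : nil_image 30%:R -> nil_image (b - b ^+ 3) ->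
  exists2 e : C, phi (e ^+ 3 - e) = 0 & nil_image (e - b).
Proof.
move=> N30 Nb.
pose p := 8%:R * b ^+ 2 + 23%:R * b; pose q := 8%:R * b ^+ 2 - 8%:R * b.
(* At the prime [2] this says that [b] is idempotent modulo [N]. *)
have N15 : nil_image (15%:R * (b ^+ 2 + b)).
  apply: (nil_image_root 2).
  have -> : (15%:R * (b ^+ 2 + b)) ^+ 2 =
      30%:R * (15%:R * (b ^+ 2 + b)) - (b - b ^+ 3) * (225%:R * (b + 2%:R)).
    by ring.
  by apply: nil_imageB; apply: nil_imageM.
have [|f ff Nf] := idempotent_lift p.
  have -> : p - p ^+ 2 = (b - b ^+ 3) * (64%:R * b + 368%:R)
      - 30%:R * (19%:R * b ^+ 2 + 11%:R * b) - 15%:R * (b ^+ 2 + b).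
    by rewrite /p; ring.
  by apply: nil_imageB => //; apply: nil_imageB; apply: nil_imageM.
have [|g gg Ng] := idempotent_lift q.
  have -> : q - q ^+ 2 = (b - b ^+ 3) * (64%:R * (b - 2%:R))
      + 30%:R * (4%:R * (b - b ^+ 2)) by rewrite /q; ring.
  by apply: nil_imageD; apply: nil_imageM.
have fg0 : phi (f * g) = 0.
  apply: idempotent_nil_image_eq0.
    have -> : (f * g) ^+ 2 - f * g
        = (f ^+ 2 - f) * g ^+ 2 + (g ^+ 2 - g) * f by ring.
    by rewrite rmorphD !rmorphM ff gg !mul0r addr0.
  have -> : f * g = (f - p) * g + (g - q) * p + (30%:R * (4%:R * (b - b ^+ 2))
      - (b - b ^+ 3) * (64%:R * b + 120%:R)).
    by rewrite /p /q; ring.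
  by apply: nil_imageD; [apply: nil_imageD | apply: nil_imageB];
    apply: nil_imageM.
exists (f - g).
  have -> : (f - g) ^+ 3 - (f - g) = (f ^+ 2 - f) * (f + 1)
      - (g ^+ 2 - g) * (g + 1) + (f * g) * (3%:R * (g - f)) by ring.
  by rewrite rmorphD (rmorphM phi (f * g)) fg0 rmorphB !rmorphM ff gg !mul0r
    subrr addr0.
have -> : f - g - b = (f - p) - (g - q) + 30%:R * b by rewrite /p /q; ring.
by apply: nil_imageD; [apply: nil_imageB | apply: nil_imageM].
Qed.

(** * The two conditions compared *)

(** A square root [a] of [-1] in a field of characteristic [3] would give an
    element [1 + a] of multiplicative order [8], which satisfies neither
    [b^3 = b] nor [b^3 = -b]; so where [2] is invertible, [a] is nilpotent. *)
Lemma nil_image_double a : nil_image 6%:R -> nil_image (a + a ^+ 3) ->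
  nil_image ((1 + a) + (1 + a) ^+ 3) \/ nil_image ((1 + a) - (1 + a) ^+ 3) ->
  nil_image (2%:R * a).
Proof.
move=> N6 Na [Nb|Nb].
  apply: nil_imageM; apply: (nil_image_root 2).
  have -> : 2%:R ^+ 2 = ((1 + a) + (1 + a) ^+ 3) * 2%:R
      - 6%:R * (a + a ^+ 2) - (a + a ^+ 3) * 2%:R :> C by ring.
  by apply: nil_imageB; [apply: nil_imageB|]; apply: nil_imageM.
have -> : 2%:R * a = - (((1 + a) - (1 + a) ^+ 3) * 2%:R
    + 6%:R * a ^+ 2 + (a + a ^+ 3) * 2%:R) by ring.
by apply: nil_imageN; apply: nil_imageD; [apply: nil_imageD|];
  apply: nil_imageM.
Qed.

Lemma tripotent_approximation a : nil_image 10%:R \/ nil_image 6%:R ->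
  (forall x, nil_image (x + x ^+ 3) \/ nil_image (x - x ^+ 3)) ->
  exists2 e : C, phi (e ^+ 3 - e) = 0 &
    nil_image (a - e) \/ nil_image (a + 3%:R * e).
Proof.
move=> N10_6 ync.
have N30 : nil_image 30%:R.
  case: N10_6 => Nk.
    have -> : 30%:R = 10%:R * 3%:R :> C by ring.
    exact: nil_imageM.
  have -> : 30%:R = 6%:R * 5%:R :> C by ring.
  exact: nil_imageM.
have lift_minus : nil_image (a - a ^+ 3) -> exists2 e : C,
    phi (e ^+ 3 - e) = 0 & nil_image (a - e) \/ nil_image (a + 3%:R * e).
  move=> /(tripotent_lift _ N30)[e ee Ne]; exists e => //; left.
  by rewrite -opprB; apply: nil_imageN.
case: (ync a) => [Na|/lift_minus //]; case: N10_6 => [N10|N6].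
  have [|e ee Ne] := tripotent_lift (3%:R * a) N30.
    have -> : 3%:R * a - (3%:R * a) ^+ 3
        = 30%:R * a - (a + a ^+ 3) * 27%:R by ring.
    by apply: nil_imageB; apply: nil_imageM.
  exists e => //; right.
  have -> : a + 3%:R * e = (e - 3%:R * a) * 3%:R + 10%:R * a by ring.
  by apply: nil_imageD; apply: nil_imageM.
apply: lift_minus.
have -> : a - a ^+ 3 = 2%:R * a - (a + a ^+ 3) by ring.
by apply: nil_imageB => //; apply: nil_image_double.
Qed.

(** At [2 = e] this gives [6 = 2^3 - 2 = 0], and at [2 = -3e] it gives
    [8 = -27e = 18], that is [10 = 0]. *)
Lemma nil_image_30 e : phi (e ^+ 3 - e) = 0 ->
  nil_image (2%:R - e) \/ nil_image (2%:R + 3%:R * e) -> nil_image 30%:R.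
Proof.
move=> ee.
have Nee : nil_image (e ^+ 3 - e) by exists 1%N.
case=> Ne.
  have -> : 30%:R = ((2%:R - e) * (2%:R ^+ 2 + 2%:R * e + e ^+ 2 - 1)
      + (e ^+ 3 - e)) * 5%:R :> C by ring.
  by apply: nil_imageM; apply: nil_imageD => //; apply: nil_imageM.
have -> : 30%:R = - ((2%:R + 3%:R * e)
      * (2%:R ^+ 2 - 2%:R * (3%:R * e) + (3%:R * e) ^+ 2 - 9%:R)
    - (e ^+ 3 - e) * 27%:R) * 3%:R :> C by ring.
by apply: nil_imageM; apply: nil_imageN; apply: nil_imageB; apply: nil_imageM.
Qed.

Lemma Yaqub_of_tripotent a e : nil_image 30%:R -> phi (e ^+ 3 - e) = 0 ->
  nil_image (a - e) \/ nil_image (a + 3%:R * e) ->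
  nil_image (a + a ^+ 3) \/ nil_image (a - a ^+ 3).
Proof.
move=> N30 ee.
have Nee : nil_image (e ^+ 3 - e) by exists 1%N.
case=> Na; [right | left].
  have -> : a - a ^+ 3
      = (a - e) * (1 - (a ^+ 2 + a * e + e ^+ 2)) - (e ^+ 3 - e) by ring.
  by apply: nil_imageB => //; apply: nil_imageM.
have -> : a + a ^+ 3 = (a + 3%:R * e)
      * (1 + (a ^+ 2 - a * (3%:R * e) + (3%:R * e) ^+ 2))
    - (e ^+ 3 - e) * 27%:R - 30%:R * e by ring.
by apply: nil_imageB; [apply: nil_imageB|]; apply: nil_imageM.
Qed.

End NilpotentImage.

Arguments nil_image {C R} phi.

Theorem theorem3p10 (R : pzRingType) :
  Yaqub_nil_clean R <->
  (forall a : R, exists e : R,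
     [/\ e ^+ 3 = e, a * e = e * a &
         nilpotent_elt (a - e) \/ nilpotent_elt (a + 3%:R * e)]).
Proof.
split=> [ync a | trip].
  have [C [phi [x [_ [<- _]]]]] := factor_commuting_pair (erefl : a * a = a * a).
  have {}ync z : nil_image phi (z + z ^+ 3) \/ nil_image phi (z - z ^+ 3).
    by rewrite /nil_image rmorphD rmorphB rmorphXn; apply: ync.
  have [|e ee Ne] := @tripotent_approximation _ _ phi x _ ync.
    case: (ync 2%:R) => N2; [left | right].
      by have <- : 2%:R + 2%:R ^+ 3 = 10%:R :> C by ring.
    have -> : 6%:R = - (2%:R - 2%:R ^+ 3) :> C by ring.
    exact: nil_imageN.
  exists (phi e); split.
  - by rewrite -rmorphXn; apply/eqP; rewrite -subr_eq0 -rmorphB ee.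
  - by rewrite -!rmorphM mulrC.
  - by move: Ne; rewrite /nil_image rmorphB rmorphD rmorphM rmorph_nat.
have nil30 : nilpotent_elt (30%:R : R).
  have [e [e3 ce Ne]] := trip 2%:R.
  have [C [phi [x [y [xE yE]]]]] := factor_commuting_pair ce.
  rewrite -(rmorph_nat phi); apply: (@nil_image_30 _ _ phi y).
    by rewrite rmorphB rmorphXn yE e3 subrr.
  rewrite /nil_image rmorphB (rmorphD phi _ (3%:R * y)) rmorphM !rmorph_nat.
  by rewrite yE.
move=> a; have [e [e3 ce Ne]] := trip a.
have [C [phi [x [y [xE yE]]]]] := factor_commuting_pair ce.
have := @Yaqub_of_tripotent _ _ phi x y.
rewrite /nil_image !(rmorph_nat, rmorphB, rmorphD, rmorphXn, rmorphM) xE yE.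
by apply => //; rewrite e3 subrr.
Qed.
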